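(* Every pair of $2\times2$ binary matrices has the oligo-vertex property.
   Context: A binary matrix is a matrix all of whose entries are in $\{0,1\}$. For a finite set $\Sigma$ of real $n\times n$ matrices, a vector $a\in\mathbb{R}^n$ and an integer $k\ge0$, let $P_k(\Sigma,a)=\mathrm{conv}\{T_{k-1}\cdots T_0a\mid T_j\in\Sigma,\ j=0,\ldots,k-1\}$ (convex hull), let $N_k(\Sigma,a)$ be the number of extreme points of $P_k(\Sigma,a)$, and let $N_k(\Sigma)=\sup_{a\in\mathbb{R}^n}N_k(\Sigma,a)$. The set $\Sigma$ has the oligo-vertex property if there exist $\alpha>0$, a positive integer $k_0$ and a positive constant $d$ such that $N_k(\Sigma)\le\alpha k^d$ for all $k\ge k_0$. *)

(* Defs.v *)
From mathcomp Require Import all_boot all_order all_algebra.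
From mathcomp Require Import all_classical all_reals all_analysis.

Set Implicit Arguments.
Unset Strict Implicit.
Unset Printing Implicit Defensive.

Import Order.TTheory GRing.Theory Num.Theory.

Local Open Scope classical_set_scope.
Local Open Scope ring_scope.

Definition convex_hull (R : numDomainType) (V : lmodType R) (A : set V) :
    set V :=
  smallest (@convex_set R V) A.

Definition extreme_points (R : numDomainType) (V : lmodType R) (P : set V) :
    set V :=
  [set x | P x /\ forall (y z : V) (t : R), P y -> P z -> 0 < t -> t < 1 ->
             x = t *: y + (1 - t) *: z -> y = x /\ z = x].

Definition binary_mx (R : realType) (m n : nat) (A : 'M[R]_(m, n)) : Prop :=
  forall i j, A i j = 0 \/ A i j = 1.

(* T_{k-1} *m ... *m T_0 *m a *)
Fixpoint trajectory (R : realType) (n : nat) (T : nat -> 'M[R]_n)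
    (a : 'cV[R]_n) (k : nat) : 'cV[R]_n :=
  if k is j.+1 then T j *m trajectory T a j else a.

Definition reach_hull (R : realType) (n : nat) (Sigma : set 'M[R]_n)
    (a : 'cV[R]_n) (k : nat) : set 'cV[R]_n :=
  convex_hull [set trajectory T a k
                | T in [set T | forall j, (j < k)%N -> Sigma (T j)]].

(* [counting] is +oo on infinite sets, so no junk value can arise here. *)
Definition vertex_number_at (R : realType) (n : nat) (Sigma : set 'M[R]_n)
    (a : 'cV[R]_n) (k : nat) : \bar R :=
  counting (extreme_points (reach_hull Sigma a k)).

Definition vertex_number (R : realType) (n : nat) (Sigma : set 'M[R]_n)
    (k : nat) : \bar R :=
  ereal_sup [set vertex_number_at Sigma a k | a in [set: 'cV[R]_n]].

Definition oligo_vertex (R : realType) (n : nat) (Sigma : set 'M[R]_n) :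
    Prop :=
  exists (alpha : R) (k0 : nat) (d : R),
    [/\ 0 < alpha, (0 < k0)%N, 0 < d &
      forall k : nat, (k0 <= k)%N ->
        (vertex_number Sigma k <= (alpha * (k%:R `^ d))%:E)%E].

(* Main.v *)
Require Import Defs.
From mathcomp Require Import all_boot all_order all_algebra.
From mathcomp Require Import all_classical all_reals all_analysis.
From mathcomp Require finmap.
From mathcomp Require Import zify ring lra.

(* An extreme point of the hull of a finite set X is the unique maximizer over X
   of some functional c, so one counts unique maximizers. Let X_k be the set of
   points reached after k letters; then X_{k+1} = A X_k u B X_k, and maximizing c
   over T X_k amounts to maximizing c T over X_k.

   If A is singular, the points of X_k lie on k lines through 0, up to one point;
   if A and B commute, X_k has at most k + 1 points. Up to conjugation by the
   coordinate swap J six pairs remain. Let first a >= 0. For c in the positive or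
   in the negative quadrant, after discarding dominated letters, A and B map
   cones of functionals into cones with disjoint interiors, so that the number
   of maximizers grows by at most one per step. For c in a mixed quadrant one
   letter always dominates (with one letter of look-ahead), and the images lie in
   the definite quadrants and one mixed quadrant: the bounds add up to a
   quadratic one. Finally, if a has mixed signs, all but one of the branches of
   the tree of words leave the mixed quadrants within two steps, which gives a
   cubic bound. *)

Set Implicit Arguments.
Unset Strict Implicit.
Unset Printing Implicit Defensive.

Import Order.TTheory GRing.Theory Num.Theory.

Local Open Scope classical_set_scope.
Local Open Scope ring_scope.

(** * Exposed points *)

Section Exposed.
Variables (R : realType) (n : nat).
Implicit Types (c : 'rV[R]_n) (v w : 'cV[R]_n).

Definition dot c v : R := (c *m v) 0 0.

Lemma dot_mul c (T : 'M[R]_n) v : dot (c *m T) v = dot c (T *m v).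
Proof. by rewrite /dot mulmxA. Qed.

Lemma dotDr c v w : dot c (v + w) = dot c v + dot c w.
Proof. by rewrite /dot mulmxDr mxE. Qed.

Lemma dotZr c t v : dot c (t *: v) = t * dot c v.
Proof. by rewrite /dot -scalemxAr mxE. Qed.

Lemma dotNr c v : dot c (- v) = - dot c v.
Proof. by rewrite /dot mulmxN mxE. Qed.

Lemma dotBr c v w : dot c (v - w) = dot c v - dot c w.
Proof. by rewrite dotDr dotNr. Qed.

Lemma dotDl c c' v : dot (c + c') v = dot c v + dot c' v.
Proof. by rewrite /dot mulmxDl mxE. Qed.

Lemma dotZl c t v : dot (t *: c) v = t * dot c v.
Proof. by rewrite /dot -scalemxAl mxE. Qed.

Lemma dotNl c v : dot (- c) v = - dot c v.
Proof. by rewrite /dot mulNmx mxE. Qed.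

Lemma dotBl c c' v : dot (c - c') v = dot c v - dot c' v.
Proof. by rewrite dotDl dotNl. Qed.

End Exposed.

(** * Farkas' lemma, convex hulls and separation *)

Definition convex_cone (R : realType) (n : nat) (K : set 'cV[R]_n) : Prop :=
  [/\ K 0, forall x y, K x -> K y -> K (x + y) &
      forall t x, 0 <= t -> K x -> K (t *: x)].

(* Induction on the generators: a functional c that separates b from the first
   generators but is negative on the last generator z is corrected by projecting
   everything onto the kernel of c along z. *)
Lemma farkas (R : realType) (n : nat) (s : seq 'cV[R]_n) (b : 'cV[R]_n) :
  (forall K, convex_cone K -> {in s, forall z, K z} -> K b) \/
  exists c, {in s, forall z, 0 <= dot c z} /\ dot c b < 0.
Proof.
have [k] := ubnP (size s); elim: k => // k IH in s b *; case: s => [_|z s].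
  have [->|b0] := eqVneq b 0; first by left => K [].
  have /existsP[i bi] : [exists i, b i 0 != 0].
    apply: contraNT b0 => /existsPn b0; apply/eqP/colP => i; rewrite mxE.
    by apply/eqP; move/negbNE: (b0 i).
  right; exists (- b i 0 *: delta_mx 0 i); split=> //.
  rewrite dotZl /dot -rowE mxE mulNr oppr_lt0.
  by rewrite -expr2 lt_neqAle eq_sym sqrf_eq0 bi sqr_ge0.
rewrite ltnS /= => sk.
have [Kb|[c [cs cb]]] := IH s b sk.
  left => K coneK sK; apply: Kb => // y ys; apply: sK.
  by rewrite inE ys orbT.
have [cz|cz] := leP 0 (dot c z).
  right; exists c; split=> // y; rewrite inE => /orP[/eqP -> //|]; exact: cs.
pose proj v := v - (dot c v / dot c z) *: z.
have [Kb|[d [ds db]]] := IH (map proj s) (proj b) ltac:(by rewrite size_map).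
  left => K [K0 KD KZ] sK.
  have Kz : K z by apply: sK; rewrite inE eqxx.
  have -> : b = proj b + (dot c b / dot c z) *: z by rewrite /proj subrK.
  (* Both [dot c b] and [dot c z] are negative, so the coefficient of [z] is nonnegative. The same
     sign argument puts each [proj y] in [K]. *)
  apply: (KD); last by apply: (KZ) => //; rewrite mulr_le0 ?invr_le0 ?ltW.
  apply: Kb => // _ /mapP[y ys ->]; rewrite /proj -scaleNr; apply: (KD).
    by apply: sK; rewrite inE ys orbT.
  by apply: (KZ) => //; rewrite oppr_ge0 mulr_ge0_le0 ?invr_le0 ?cs// ltW.
(* The corrected functional is [d] composed with the projection; in particular it vanishes on
   [z]. *)
have dE v : dot (d - (dot d z / dot c z) *: c) v = dot d (proj v).
  rewrite dotBl dotZl /proj dotBr dotZr; congr (_ - _).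
  by rewrite mulrAC [RHS]mulrAC; congr (_ / _); rewrite mulrC.
right; exists (d - (dot d z / dot c z) *: c); split; last by rewrite dE.
move=> y; rewrite inE => /orP[/eqP ->|ys]; last first.
  by rewrite dE; apply: ds; apply/mapP; exists y.
by rewrite dotBl dotZl divfK ?subrr// lt_eqF.
Qed.

Lemma convex_setP (R : realType) (V : lmodType R) (A : set V) :
  convex_set A <-> forall x y (t : R), A x -> A y -> 0 < t -> t < 1 ->
    A (t *: x + (1 - t) *: y).
Proof.
split=> [cA x y t Ax Ay t0 t1|cA].
  have t01 : 0 <= t <= 1 by rewrite !ltW.
  have /= := cA x y (Itv01 (ltW t0) (ltW t1)).
  by rewrite !inE => /(_ Ax Ay).
apply/convex_setW => x y; rewrite !inE => Ax Ay t t0 t1.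
rewrite inE; exact: cA.
Qed.

Lemma convex_hull_sub (R : realType) (V : lmodType R) (A M : set V) :
  convex_set M -> A `<=` M -> convex_hull A `<=` M.
Proof. by move=> cM AM x /(_ M); apply. Qed.

Lemma sub_convex_hull (R : realType) (V : lmodType R) (A : set V) :
  A `<=` convex_hull A.
Proof. by move=> x Ax M [_]; apply. Qed.

Lemma convex_hull_convex (R : realType) (V : lmodType R) (A : set V) :
  convex_set (convex_hull A).
Proof.
apply/convex_setP => x y t Ax Ay t0 t1 M [cM AM].
by apply: (proj1 (convex_setP M) cM) => //; [exact: Ax | exact: Ay].
Qed.

(* Farkas' lemma for the cone over s placed at height one. *)
Lemma separation (R : realType) (n : nat) (s : seq 'cV[R]_n) (v : 'cV[R]_n)
    (M : set 'cV[R]_n) :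
  convex_set M -> {in s, forall y, M y} -> ~ M v ->
  exists c, {in s, forall y, dot c y < dot c v}.
Proof.
move=> /convex_setP cM sM Mv.
pose lift (y : 'cV[R]_n) : 'cV[R]_(n + 1) := col_mx y 1%:M.
pose K : set 'cV[R]_(n + 1) :=
  [set w | w = 0 \/ exists t y, [/\ 0 < t, M y & w = t *: lift y]].
have coneK : convex_cone K.
  split; first by left.
  - move=> _ _ [->|[t [x [t0 Mx ->]]]] [->|[r [y [r0 My ->]]]].
    + by left; rewrite addr0.
    + by right; exists r, y; rewrite add0r.
    + by right; exists t, x; rewrite addr0.
    have tr0 : 0 < t + r by rewrite addr_gt0.
    right; exists (t + r), ((t / (t + r)) *: x + (1 - t / (t + r)) *: y).
    split=> //.
      apply: cM => //; first by rewrite divr_gt0.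
      by rewrite ltr_pdivrMr// mul1r ltrDl.
    rewrite /lift !scale_col_mx add_col_mx -scalerDl; congr col_mx.
    rewrite scalerDr !scalerA mulrBr mulr1 [(t + r) * _]mulrC divfK ?gt_eqF//.
    by rewrite addrAC subrr add0r.
  - move=> t y; rewrite le_eqVlt => /orP[/eqP <- _|t0].
      by left; rewrite scale0r.
    move=> [->|[r [x [r0 Mx ->]]]]; first by left; rewrite scaler0.
    by right; exists (t * r), x; rewrite mulr_gt0// scalerA.
have dotE d (y : 'cV[R]_n) :
    dot d (lift y) = dot (lsubmx d) y + dot (rsubmx d) 1%:M.
  by rewrite /dot -[in LHS](hsubmxK d) mul_row_col mxE.
have [/(_ K coneK)|[d [ds dv]]] := farkas (map lift s) (lift v).
  case=> [_ /mapP[y ys ->]||[t [y [t0 My]]]].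
  - by right; exists 1, y; rewrite scale1r; split=> //; exact: sM.
  - rewrite /lift -col_mx0 => /eq_col_mx[_ /matrixP/(_ 0 0)/eqP].
    by rewrite !mxE/= oner_eq0.
  (* The last coordinate is one on both sides, which forces [t = 1] and hence [y = v]. *)
  rewrite /lift scale_col_mx => /eq_col_mx[vE /matrixP/(_ 0 0)].
  rewrite !mxE/= mulr1 => t1; move: vE My; rewrite -t1 scale1r => <-.
  by move/Mv.
(* The last coordinate of [d] adds the same constant on both sides and cancels. The sign change
   turns [v] from minimizer into maximizer. *)
exists (- lsubmx d) => y ys; rewrite !dotNl ltrN2.
have := ds (lift y) (map_f _ ys); move: dv; rewrite !dotE; lra.
Qed.

(** * Extreme points as unique maximizers *)

Section StrictMaximizers.
Variables (R : realType) (n : nat).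
Implicit Types (X : set 'cV[R]_n) (D : set 'rV[R]_n).

Definition strict_max X (c : 'rV[R]_n) (v : 'cV[R]_n) : Prop :=
  X v /\ forall y, X y -> y != v -> dot c y < dot c v.

(** The functionals are restricted to [D] so that counts can be followed cone by cone. *)
Definition exposed X D : set 'cV[R]_n :=
  [set v | exists2 c, D c & strict_max X c v].

(** Extremality makes the hull minus [v] convex. Hence [v] lies in [X], as otherwise this smaller
    convex set would contain [X]; separating [v] from the finitely many other points of [X] gives
    the functional. *)
Lemma extreme_points_exposed (s : seq 'cV[R]_n) X :
  X `<=` [set` s] -> extreme_points (convex_hull X) `<=` exposed X setT.
Proof.
move=> Xs v [hv ev]; set H := convex_hull X in hv ev.
have cM : convex_set (H `\ v).
  apply/convex_setP => x y t [Hx xv] [Hy yv] t0 t1; split.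
    by have /convex_setP := @convex_hull_convex R _ X; apply.
  by move=> /= /esym /(ev _ _ _ Hx Hy t0 t1) [].
have Xv : X v.
  apply: contrapT => Xv.
  have XM : X `<=` H `\ v.
    move=> x Xx; split; first exact: sub_convex_hull.
    by move=> xv; apply: Xv; rewrite -xv.
  by have [_] := convex_hull_sub cM XM hv; apply.
pose s' := [seq y <- s | `[< X y >] & y != v].
have s'M : {in s', forall y, (H `\ v) y}.
  move=> y; rewrite mem_filter => /andP[/andP[/asboolP Xy /eqP yv] _].
  by split=> //; exact: sub_convex_hull.
have [|c cs] := separation cM s'M (v := v); first by case=> _; apply.
exists c => //; split=> // y Xy yv; apply: cs.
by rewrite mem_filter yv andbT asboolT//=; exact: Xs.
Qed.

End StrictMaximizers.

(** * Cardinality bounds *)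

Section AtMost.
Variables (T : choiceType).
Implicit Types (X Y : set T) (m : nat).

(** The list only has to cover [X]: it may repeat elements or leave [X], so bounds pass directly to
    subsets, unions and images. *)
Definition at_most m X : Prop :=
  exists s : seq T, (size s <= m)%N /\ X `<=` [set` s].

Lemma at_mostW m m' X Y :
  (m <= m')%N -> Y `<=` X -> at_most m X -> at_most m' Y.
Proof.
move=> mm' YX [s [sm Xs]]; exists s; split; first exact: leq_trans mm'.
exact: subset_trans Xs.
Qed.

Lemma at_mostU m1 m2 X Y :
  at_most m1 X -> at_most m2 Y -> at_most (m1 + m2) (X `|` Y).
Proof.
move=> [s [sm Xs]] [t [tm Yt]]; exists (s ++ t).
rewrite size_cat leq_add//; split=> // x /= [/Xs|/Yt] /= xs;
  by rewrite mem_cat xs ?orbT.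
Qed.

Lemma at_most1 X : (forall x y, X x -> X y -> x = y) -> at_most 1 X.
Proof.
move=> X1; have [[x Xx]|nX] := pselect (exists x, X x).
  by exists [:: x]; split=> // y Xy /=; rewrite (X1 y x)// mem_seq1.
by exists [::]; split=> // y Xy; case: nX; exists y.
Qed.

Lemma at_most_bigU (F : nat -> set T) m k X :
  (forall i, (i < k)%N -> at_most m (F i)) ->
  X `<=` [set x | exists2 i, (i < k)%N & F i x] -> at_most (m * k) X.
Proof.
elim: k X => [|k IH] X Fm Xs; first by exists [::]; split=> // x /Xs[].
rewrite mulnS; have Fk := Fm k (leqnn _).
have Fi i : (i < k)%N -> at_most m (F i) by move=> /ltnW; exact: Fm.
apply: (at_mostW (leqnn _) _ (at_mostU Fk (IH _ Fi (@subset_refl _ _)))).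
move=> x /Xs[i]; rewrite ltnS leq_eqVlt => /orP[/eqP ->|ik] Fx; first by left.
by right; exists i.
Qed.

Lemma counting_le (R : realType) m X :
  at_most m X -> (counting X <= (m%:R : R)%:E)%E.
Proof.
move=> [s [sm Xs]]; have fX : finite_set X by exact: sub_finite_set (finite_seq s).
rewrite /counting asboolT// lee_fin ler_nat; apply: leq_trans sm.
apply: uniq_leq_size; first exact: finmap.fset_uniq.
by move=> x; rewrite in_fset_set// => /set_mem/Xs.
Qed.

(** Inclusion and exclusion on a duplicate-free list: the one element that [X1] and [X2] may share
    accounts for the successor in [m.+1]. *)
Lemma at_most_split m X X1 X2 :
  at_most m X -> X1 `<=` X -> X2 `<=` X ->
  (forall x y, X1 x -> X2 x -> X1 y -> X2 y -> x = y) ->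
  exists m1 m2, [/\ (m1 + m2 <= m.+1)%N, at_most m1 X1 & at_most m2 X2].
Proof.
move=> [s [sm Xs]] X1X X2X X12.
pose P1 := [pred x | `[< X1 x >]]; pose P2 := [pred x | `[< X2 x >]].
exists (count P1 (undup s)), (count P2 (undup s)); split.
- rewrite -count_predUI -addn1; apply: leq_add.
    by rewrite (leq_trans (count_size _ _))// (leq_trans (size_undup _)).
  rewrite -size_filter.
  have := filter_uniq (predI P1 P2) (undup_uniq s).
  case E : (seq.filter _ _) => [|x [|y t]]//=; rewrite inE.
  move=> /andP[/norP[/eqP xy _] _].
  have : x \in seq.filter (predI P1 P2) (undup s) by rewrite E inE eqxx.
  have : y \in seq.filter (predI P1 P2) (undup s) by rewrite E !inE eqxx orbT.
  rewrite !mem_filter /= => /andP[/andP[/asboolP y1 /asboolP y2] _].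
  move=> /andP[/andP[/asboolP x1 /asboolP x2] _].
  by case: xy; apply: X12.
- exists (seq.filter P1 (undup s)); rewrite size_filter; split=> // x x1 /=.
  by rewrite mem_filter /= asboolT//= mem_undup; exact/Xs/X1X.
- exists (seq.filter P2 (undup s)); rewrite size_filter; split=> // x x2 /=.
  by rewrite mem_filter /= asboolT//= mem_undup; exact/Xs/X2X.
Qed.

End AtMost.

Lemma at_most_image (T U : choiceType) (f : T -> U) m (X : set T) (Y : set U) :
  Y `<=` f @` X -> at_most m X -> at_most m Y.
Proof.
move=> YX [s [sm Xs]]; exists (map f s); rewrite size_map; split=> // y /YX[x /Xs].
by move=> /= xs <-; exact: map_f.
Qed.

(** * Counting exposed points *)

Section ExposedCount.
Variables (R : realType) (n : nat).
Implicit Types (X : set 'cV[R]_n) (D : set 'rV[R]_n).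

Definition vbound m X D := at_most m (exposed X D).

Lemma strict_max_le X c v y :
  strict_max X c v -> X y -> dot c v <= dot c y -> y = v.
Proof.
move=> [Xv mv] Xy; have [->//|yv] := eqVneq y v.
by rewrite leNgt mv.
Qed.

Lemma strict_maxW X Y c v : Y `<=` X -> Y v -> strict_max X c v -> strict_max Y c v.
Proof. by move=> YX Yv [_ mv]; split=> // y /YX; exact: mv. Qed.

Lemma strict_max_comb X c c' v (x y : R) : 0 <= x -> 0 <= y -> 0 < x + y ->
  strict_max X c v -> strict_max X c' v -> strict_max X (x *: c + y *: c') v.
Proof.
move=> x0 y0 xy [Xv mv] [_ mv']; split=> // z Xz zv.
have lt1 := mv z Xz zv; have lt2 := mv' z Xz zv; rewrite !dotDl !dotZl.
move: x0; rewrite le_eqVlt => /orP[/eqP x0|x0].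
  by move: xy; rewrite -x0 !mul0r !add0r => y1; rewrite ltr_pM2l.
by apply: ltr_leD; rewrite ?ltr_pM2l// ler_wpM2l// ltW.
Qed.

(** The case [t = 0] is covered: the zero functional has a strict maximizer only on a singleton. *)
Lemma strict_max_scale X c v (t : R) :
  0 <= t -> strict_max X (t *: c) v -> strict_max X c v.
Proof.
move=> t0 [Xv mv]; split=> // z Xz zv; have := mv z Xz zv; rewrite !dotZl; nra.
Qed.

Lemma vboundW m m' X D D' : (m <= m')%N -> D' `<=` D -> vbound m X D ->
  vbound m' X D'.
Proof.
move=> mm' DD; apply: at_mostW => // v [c /DD]; by exists c.
Qed.

Lemma vbound_finite m X D : at_most m X -> vbound m X D.
Proof. by apply: at_mostW => // v [c _ []]. Qed.

Lemma vboundU m1 m2 X D D1 D2 : D `<=` D1 `|` D2 ->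
  vbound m1 X D1 -> vbound m2 X D2 -> vbound (m1 + m2) X D.
Proof.
move=> DD b1 b2; apply: at_mostW (at_mostU b1 b2) => // v [c /DD[Dc|Dc] cv];
  by [left; exists c|right; exists c].
Qed.

Lemma vbound_cover m1 m2 X X1 X2 D : X `<=` X1 `|` X2 -> X1 `<=` X -> X2 `<=` X ->
  vbound m1 X1 D -> vbound m2 X2 D -> vbound (m1 + m2) X D.
Proof.
move=> XX s1 s2 b1 b2; apply: at_mostW (at_mostU b1 b2) => // v [c Dc cv].
by case: (XX v (proj1 cv)) => Xv; [left|right]; exists c => //;
  exact: strict_maxW cv.
Qed.

Lemma vbound_opp m X : vbound m X setT -> vbound m (-%R @` X) setT.
Proof.
apply: at_most_image (-%R) _ _ _ _ => v [c _ [[w Xw <-] mw]].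
exists w => //; exists (- c) => //; split=> // y Xy yw.
rewrite !dotNl -!dotNr; apply: mw; first by exists y.
by rewrite (inj_eq oppr_inj).
Qed.

Lemma vbound_unitmx m X (T : 'M[R]_n) : T \in unitmx ->
  vbound m X setT -> vbound m [set T *m v | v in X] setT.
Proof.
move=> uT; apply: at_most_image (mulmx T) _ _ _ _ => v [c _ [[w Xw <-] mw]].
exists w => //; exists (c *m T) => //; split=> // y Xy yw.
rewrite !dot_mul; apply: mw; first by exists y.
by rewrite (inj_eq (can_inj (mulKmx uT))).
Qed.

End ExposedCount.

(** * Reachable points *)

Section Reach.
Variables (R : realType) (n : nat) (Sigma : set 'M[R]_n).
Implicit Types (a v : 'cV[R]_n) (T : 'M[R]_n).

Definition reach a k : set 'cV[R]_n :=
  [set trajectory T a k | T in [set T | forall j, (j < k)%N -> Sigma (T j)]].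

Lemma reach0 a v : reach a 0 v <-> v = a.
Proof.
split=> [[T _ <-]//|->]; by exists (fun _ => 0).
Qed.

Lemma eq_trajectory (T T' : nat -> 'M[R]_n) a k :
  (forall j, (j < k)%N -> T j = T' j) -> trajectory T a k = trajectory T' a k.
Proof.
elim: k => //= k IH TT'; rewrite TT'// IH// => j jk; apply: TT'; exact: ltnW.
Qed.

Lemma reachS a k v :
  reach a k.+1 v <-> exists T y, [/\ Sigma T, reach a k y & v = T *m y].
Proof.
split=> [[T ST <-]|[T [_ [ST [U SU <-] ->]]]].
  exists (T k), (trajectory T a k); split=> //; first exact: ST.
  by exists T => // j jk; apply: ST; exact: ltnW.
exists (fun j => if j == k then T else U j) => [j|] /=.
  by case: eqVneq => // jk; rewrite ltnS leq_eqVlt (negbTE jk); exact: SU.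
rewrite eqxx; congr (_ *m _); apply: eq_trajectory => j jk.
by rewrite ltn_eqF.
Qed.

(** Splits off the letter that acts first and so changes the starting point; [reachS] splits off the
    last one, which moves to the functional. *)
Lemma reachSr a k v :
  reach a k.+1 v <-> exists T, Sigma T /\ reach (T *m a) k v.
Proof.
elim: k v => [|k IH] v.
  split.
    by move=> /reachS[T [y [ST /reach0 -> ->]]]; exists T; split=> //; exact/reach0.
  by move=> [T [ST /reach0 ->]]; apply/reachS; exists T, a; split=> //; exact/reach0.
split.
  move=> /reachS[T [y [ST /IH[U [SU ry]] ->]]]; exists U; split=> //.
  by apply/reachS; exists T, y.
move=> [U [SU /reachS[T [y [ST ry ->]]]]]; apply/reachS; exists T, y; split=> //.
by apply/IH; exists U.
Qed.

Lemma reach_opp a k : reach (- a) k = -%R @` reach a k.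
Proof.
apply/seteqP; elim: k => [|k [IH1 IH2]].
  split=> v; first by move=> /reach0 ->; exists a => //; exact/reach0.
  by move=> [w /reach0 -> <-]; exact/reach0.
split=> v.
  move=> /reachS[T [_ [ST /IH1[y ry <-] ->]]]; exists (T *m y).
    by apply/reachS; exists T, y.
  by rewrite mulmxN.
move=> [_ /reachS[T [y [ST ry ->]]] <-]; apply/reachS; exists T, (- y).
by rewrite mulmxN; split=> //; apply: IH2; exists y.
Qed.

End Reach.

Lemma at_most_reach (R : realType) n (A B : 'M[R]_n) a k :
  at_most (2 ^ k) (reach [set A; B] a k).
Proof.
elim: k => [|k IH].
  by exists [:: a]; split=> // v /reach0 -> /=; rewrite mem_seq1.
rewrite expnS mul2n -addnn.
have imb (T : 'M[R]_n) : at_most (2 ^ k) (mulmx T @` reach [set A; B] a k).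
  exact: (at_most_image (@subset_refl _ _) IH).
apply: (at_mostW (leqnn _) _ (at_mostU (imb A) (imb B))) => v.
by case/reachS => T [y [[->|->] ry ->]]; [left|right]; exists y.
Qed.

Lemma oligo_vertex_bound (R : realType) n (A B : 'M[R]_n) (C : nat) :
  (forall a k, vbound (C * k.+1 ^ 3) (reach [set A; B] a k) setT) ->
  oligo_vertex [set A; B].
Proof.
(* For [k >= 1] one has [k + 1 <= 2 * k], whence the factor 8; [C.+1] keeps the constant
   positive. *)
move=> bC; exists (C.+1 * 8)%:R, 1%N, 3%:R; split=> // k k1.
apply/ge_ereal_sup => _ [a _ <-].
have [s [_ sP]] := at_most_reach A B a k.
have := counting_le R (at_mostW (leqnn _) (extreme_points_exposed sP) (bC a k)).
move=> /le_trans; apply; rewrite lee_fin powR_mulrn// -natrX -natrM ler_nat.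
rewrite -mulnA (_ : 8 * k ^ 3 = (2 * k) ^ 3)%N; last by rewrite expnMn.
apply: leq_mul => //; rewrite leq_exp2r//; lia.
Qed.

(** * Singular and commuting pairs *)

(** On the line a functional acts through the sign of [dot c u], and two functionals of the same
    sign cannot strictly prefer different points. Each sign contributes one point. *)
Lemma strict_max_line (R : realType) n (X : set 'cV[R]_n) (u : 'cV[R]_n) :
  at_most 2 (exposed X setT `&` [set v | exists t, v = t *: u]).
Proof.
pose half (e : R) := [set v | exists t c,
  [/\ v = t *: u, strict_max X c v & 0 <= e * dot c u]].
have half1 (e : R) : e != 0 -> at_most 1 (half e).
  move=> e0; apply: at_most1 => _ _ [t [c [-> cv cu]]] [t' [c' [-> cv' cu']]].
  have [//|tt] := eqVneq (t *: u) (t' *: u).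
  have := (proj2 cv) _ (proj1 cv'); have := (proj2 cv') _ (proj1 cv).
  rewrite tt eq_sym tt !dotZr => /(_ isT) lt1 /(_ isT) lt2.
  have : 0 <= e ^+ 2 * (dot c u * dot c' u).
    by rewrite expr2 mulrACA mulr_ge0.
  rewrite pmulr_rge0 ?exprn_even_gt0// => uu.
  have h1 : 0 < (t' - t) * dot c' u by rewrite mulrBl subr_gt0.
  have h2 : 0 < (t - t') * dot c u by rewrite mulrBl subr_gt0.
  by exfalso; have := mulr_ge0 (sqr_ge0 (t - t')) uu; have := mulr_gt0 h1 h2; nra.
have N1 : (-1 : R) != 0 by rewrite oppr_eq0 oner_neq0.
apply: (at_mostW (leqnn _) _ (at_mostU (half1 1 (oner_neq0 _)) (half1 _ N1))).
move=> v [[c _ cv] [t vE]]; have [cu|cu] := leP 0 (dot c u).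
  by left; exists t, c; rewrite mul1r.
by right; exists t, c; rewrite mulN1r oppr_ge0 ltW.
Qed.

(** The last occurrence of [u *m w] resets the trajectory to a multiple of [u], after which only [B]
    acts. This leaves [k] lines with two exposed points each, and the point of the word without
    [u *m w]. *)
Lemma rank1_bound (R : realType) n (u : 'cV[R]_n) (w : 'rV[R]_n) (B : 'M[R]_n)
    a k :
  vbound (1 + 2 * k) (reach [set u *m w; B] a k) setT.
Proof.
set X := reach _ a k.
have XE v : X v -> v = iter k (mulmx B) a \/
    exists2 i, (i < k)%N & exists t, v = t *: iter i (mulmx B) u.
  rewrite {}/X; elim: k v => [v /reach0 ->|k IH v]; first by left.
  case/reachS => T [y [[->|->] ry ->]].
    right; exists 0%N => //; exists ((w *m y) 0 0).
    by rewrite -mulmxA {1}[w *m y]mx11_scalar mul_mx_scalar.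
  case: (IH y ry) => [->|[i ik [t ->]]]; first by left.
  by right; exists i.+1 => //; exists t; rewrite -scalemxAr.
have one : at_most 1 [set iter k (mulmx B) a] by apply: at_most1 => x y -> ->.
have lines := @at_most_bigU _ (fun i => exposed X setT `&`
  [set v | exists t, v = t *: iter i (mulmx B) u]) 2 k _
  (fun i _ => strict_max_line _ _) (@subset_refl _ _).
apply: (at_mostW (leqnn _) _ (at_mostU one lines)) => v ev.
case: (ev) => c _ [Xv _]; case: (XE v Xv) => [|[i ik tv]]; first by left.
by right; exists i.
Qed.

(** The point reached depends only on the number of letters equal to [A], which ranges from 0 to
    [k]. *)
Lemma commuting_bound (R : realType) n (A B : 'M[R]_n) a k :
  A *m B = B *m A -> vbound k.+1 (reach [set A; B] a k) setT.
Proof.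
move=> AB; apply: vbound_finite.
pose F i := [set iter i (mulmx A) (iter (k - i) (mulmx B) a)].
rewrite -[k.+1]mul1n; apply: (@at_most_bigU _ F) => [i _|].
  by apply: at_most1 => x y -> ->.
rewrite {}/F; elim: k => [v /reach0 ->|k IH v]; first by exists 0%N.
case/reachS => T [y [ST /IH[i ik yE] ->]].
case: ST => ->; [exists i.+1 => //; by rewrite yE subSS|exists i => /=].
  exact: leqW.
rewrite yE subSn//=; move: (iter (k - i) _ a) => w.
elim: i {ik yE} => //= i IHi.
by rewrite mulmxA -AB -mulmxA IHi.
Qed.

Lemma conj_bound (R : realType) n (J A B : 'M[R]_n) m k :
  J *m J = 1%:M ->
  (forall a, vbound m (reach [set A; B] a k) setT) ->
  forall a, vbound m (reach [set J *m A *m J; J *m B *m J] a k) setT.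
Proof.
move=> JJ AB a; have uJ : J \in unitmx by case/mulmx1_unit: JJ.
have JK (v : 'cV[R]_n) : J *m (J *m v) = v by rewrite mulmxA JJ mul1mx.
suff -> : reach [set J *m A *m J; J *m B *m J] a k =
    [set J *m v | v in reach [set A; B] (J *m a) k].
  exact: vbound_unitmx.
apply/seteqP; elim: k {AB} => [|k [IH1 IH2]]; split=> v.
- by move=> /reach0 ->; exists (J *m a) => //; exact/reach0.
- by move=> [_ /reach0 -> <-]; apply/reach0.
- case/reachS => T [_ [ST /IH1[y ry <-] ->]].
  by case: ST => ->; [exists (A *m y)|exists (B *m y)]; rewrite -?mulmxA ?JK//;
    apply/reachS; [exists A, y|exists B, y]; split=> //; [left|right].
- case=> _ /reachS[T [y [ST ry ->]] <-]; apply/reachS.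
  exists (J *m T *m J), (J *m y); split; last by rewrite -!mulmxA JK.
    by case: ST => ->; [left|right].
  by apply: IH2; exists y.
Qed.

(** * Two-by-two letters *)

Section Plane.
Variable R : realType.
Implicit Types (c : 'rV[R]_2) (a v : 'cV[R]_2) (A B T : 'M[R]_2).

Definition mx2 (x y z t : R) : 'M[R]_2 :=
  \matrix_(i, j) if i == 0 then (if j == 0 then x else y)
                 else (if j == 0 then z else t).

Lemma mx2_00 x y z t : mx2 x y z t 0 0 = x. Proof. by rewrite mxE. Qed.
Lemma mx2_01 x y z t : mx2 x y z t 0 1 = y. Proof. by rewrite mxE. Qed.
Lemma mx2_10 x y z t : mx2 x y z t 1 0 = z. Proof. by rewrite mxE. Qed.
Lemma mx2_11 x y z t : mx2 x y z t 1 1 = t. Proof. by rewrite mxE. Qed.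

Lemma sum_ord2 (f : 'I_2 -> R) : \sum_i f i = f 0 + f 1.
Proof. by rewrite !big_ord_recl big_ord0 addr0; congr (_ + f _); exact/val_inj. Qed.

Lemma row_mulE c T j : (c *m T) 0 j = c 0 0 * T 0 j + c 0 1 * T 1 j.
Proof. by rewrite mxE sum_ord2. Qed.

Lemma col_mulE T v i : (T *m v) i 0 = T i 0 * v 0 0 + T i 1 * v 1 0.
Proof. by rewrite mxE sum_ord2. Qed.

Lemma mx2_mulE T T' i j : (T *m T') i j = T i 0 * T' 0 j + T i 1 * T' 1 j.
Proof. by rewrite mxE sum_ord2. Qed.

Lemma dotE2 c v : dot c v = c 0 0 * v 0 0 + c 0 1 * v 1 0.
Proof. by rewrite /dot mxE sum_ord2. Qed.

Lemma ord2P (i : 'I_2) : i = 0 \/ i = 1.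
Proof. by case: i => [[|[|//]]] i; [left|right]; exact/val_inj. Qed.

Lemma mx2P A B : A 0 0 = B 0 0 -> A 0 1 = B 0 1 -> A 1 0 = B 1 0 ->
  A 1 1 = B 1 1 -> A = B.
Proof.
by move=> h00 h01 h10 h11; apply/matrixP => i j; case: (ord2P i) => ->;
  case: (ord2P j) => ->.
Qed.

Definition mx2E := (row_mulE, col_mulE, mx2_mulE, mx2_00, mx2_01, mx2_10, mx2_11).

(** With the identity these are all the invertible binary matrices: the swap, two shears, and the
    Fibonacci matrix with its conjugate under the swap. *)
Definition mxJ := mx2 0 1 1 0.
Definition mxU := mx2 1 1 0 1.
Definition mxL := mx2 1 0 1 1.
Definition mxF := mx2 1 1 1 0.
Definition mxG := mx2 0 1 1 1.

Lemma row_mulJ c : ((c *m mxJ) 0 0 = c 0 1) * ((c *m mxJ) 0 1 = c 0 0).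
Proof. by rewrite !mx2E; split; ring. Qed.

Lemma row_mulU c : ((c *m mxU) 0 0 = c 0 0) * ((c *m mxU) 0 1 = c 0 0 + c 0 1).
Proof. by rewrite !mx2E; split; ring. Qed.

Lemma row_mulL c : ((c *m mxL) 0 0 = c 0 0 + c 0 1) * ((c *m mxL) 0 1 = c 0 1).
Proof. by rewrite !mx2E; split; ring. Qed.

Lemma row_mulF c : ((c *m mxF) 0 0 = c 0 0 + c 0 1) * ((c *m mxF) 0 1 = c 0 0).
Proof. by rewrite !mx2E; split; ring. Qed.

Lemma row_mulG c : ((c *m mxG) 0 0 = c 0 1) * ((c *m mxG) 0 1 = c 0 0 + c 0 1).
Proof. by rewrite !mx2E; split; ring. Qed.

Definition row_letterE := (row_mulJ, row_mulU, row_mulL, row_mulF, row_mulG).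

Lemma col_mulJ v : ((mxJ *m v) 0 0 = v 1 0) * ((mxJ *m v) 1 0 = v 0 0).
Proof. by rewrite !mx2E; split; ring. Qed.

Lemma col_mulU v : ((mxU *m v) 0 0 = v 0 0 + v 1 0) * ((mxU *m v) 1 0 = v 1 0).
Proof. by rewrite !mx2E; split; ring. Qed.

Lemma col_mulL v : ((mxL *m v) 0 0 = v 0 0) * ((mxL *m v) 1 0 = v 0 0 + v 1 0).
Proof. by rewrite !mx2E; split; ring. Qed.

Lemma col_mulF v : ((mxF *m v) 0 0 = v 0 0 + v 1 0) * ((mxF *m v) 1 0 = v 0 0).
Proof. by rewrite !mx2E; split; ring. Qed.

Lemma col_mulG v : ((mxG *m v) 0 0 = v 1 0) * ((mxG *m v) 1 0 = v 0 0 + v 1 0).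
Proof. by rewrite !mx2E; split; ring. Qed.

Definition col_letterE := (col_mulJ, col_mulU, col_mulL, col_mulF, col_mulG).

Lemma binary_mx2 A : binary_mx A ->
  (exists u (w : 'rV[R]_2), A = u *m w) \/
  [\/ A = 1%:M, A = mxJ | [\/ A = mxU, A = mxL | A = mxF \/ A = mxG]].
Proof.
move=> bA; have rk1 (p q r s : R) : A 0 0 = p * r -> A 0 1 = p * s ->
    A 1 0 = q * r -> A 1 1 = q * s -> exists u (w : 'rV[R]_2), A = u *m w.
  move=> h00 h01 h10 h11.
  exists (\col_i if i == 0 then p else q), (\row_j if j == 0 then r else s).
  by apply: mx2P; rewrite mxE big_ord1 !mxE.
case: (bA 0 0) => h00; case: (bA 0 1) => h01; case: (bA 1 0) => h10;
  case: (bA 1 1) => h11;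
  first
  [ right; constructor 1; apply: mx2P; rewrite !mxE ?h00 ?h01 ?h10 ?h11; done
  | right; constructor 2; apply: mx2P; rewrite !mx2E; done
  | right; constructor 3; constructor 1; apply: mx2P; rewrite !mx2E; done
  | right; constructor 3; constructor 2; apply: mx2P; rewrite !mx2E; done
  | right; constructor 3; constructor 3; left; apply: mx2P; rewrite !mx2E; done
  | right; constructor 3; constructor 3; right; apply: mx2P; rewrite !mx2E; done
  | left; first
    [ apply: (rk1 0 0 0 0); lra | apply: (rk1 1 0 0 1); lra
    | apply: (rk1 1 0 1 0); lra | apply: (rk1 1 0 1 1); lra
    | apply: (rk1 0 1 0 1); lra | apply: (rk1 0 1 1 0); lra
    | apply: (rk1 0 1 1 1); lra | apply: (rk1 1 1 0 1); lra
    | apply: (rk1 1 1 1 0); lra | apply: (rk1 1 1 1 1); lra ] ].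
Qed.

Definition quadrant (e f : R) : set 'rV[R]_2 :=
  [set c | 0 <= e * c 0 0 /\ 0 <= f * c 0 1].

(* The split ray is e (y, x); a point exposed from both sides of it is exposed
   by the ray itself. *)
Lemma vbound_split m (X : set 'cV[R]_2) (D D1 D2 : set 'rV[R]_2) (e x y : R) :
  vbound m X D -> D1 `<=` D -> D2 `<=` D -> 0 < x -> 0 < y -> e ^+ 2 = 1 ->
  D1 `<=` [set c | quadrant e e c /\ e * (y * c 0 1) <= e * (x * c 0 0)] ->
  D2 `<=` [set c | quadrant e e c /\ e * (x * c 0 0) <= e * (y * c 0 1)] ->
  exists m1 m2, [/\ (m1 + m2 <= m.+1)%N, vbound m1 X D1 & vbound m2 X D2].
Proof.
move=> b D1D D2D x0 y0 ee D1P D2P.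
pose r : 'rV[R]_2 := \row_j if j == 0 then e * y else e * x.
suff rmax v : exposed X D1 v -> exposed X D2 v -> strict_max X r v.
  apply: (at_most_split b).
  - by move=> v [c /D1D]; exists c.
  - by move=> v [c /D2D]; exists c.
  - move=> v v' v1 v2 v1' v2'.
    have [_ mv] := rmax v v1 v2; have [_ mv'] := rmax v' v1' v2'.
    have [//|vv] := eqVneq v v'.
    have := mv v' (proj1 (rmax v' v1' v2')); rewrite eq_sym vv => /(_ isT).
    by have := mv' v (proj1 (rmax v v1 v2)) vv => /lt_trans lt1 /lt1; rewrite ltxx.
move=> [c /D1P[[p0 q0] cl] cv] [c' /D2P[[p0' q0'] cl'] cv'].
move: c c' p0 q0 cl p0' q0' cl' cv cv' => c c'.
set p := c 0 0; set q := c 0 1; set p' := c' 0 0; set q' := c' 0 1.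
move=> p0 q0 cl p0' q0' cl' cv cv'.
(* Up to the sign [e], these are the cross products of [c'] and [c] with the direction of the ray:
   with them as weights, the combination of [c] and [c'] falls on the ray. *)
pose s := e * (y * q' - x * p'); pose s' := e * (x * p - y * q).
have s0 : 0 <= s by rewrite /s; lra.
have s0' : 0 <= s' by rewrite /s'; lra.
have [ss|ss] := ltP 0 (s + s').
  have := strict_max_comb s0 s0' ss cv cv'.
  have -> : s *: c + s' *: c' = (p * q' - p' * q) *: r.
    apply/rowP => j; rewrite !mxE; case: (ord2P j) => -> /=.
      by rewrite -/p -/p' /s /s'; ring.
    by rewrite -/q -/q' /s /s'; ring.
  apply: strict_max_scale.
  have : 0 <= y * (p * q' - p' * q).
    have -> : y * (p * q' - p' * q) = e ^+ 2 * (y * (p * q' - p' * q)).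
      by rewrite ee mul1r.
    have -> : e ^+ 2 * (y * (p * q' - p' * q)) = s * (e * p) + s' * (e * p').
      by rewrite /s /s'; ring.
    by apply: addr_ge0; apply: mulr_ge0.
  by rewrite pmulr_rge0.
(* Both weights vanish, so [c] itself already lies on the ray. *)
have s'0 : s' = 0 by lra.
have xp : x * p = y * q.
  have -> : x * p = y * q + e * s'
    by rewrite /s' mulrA -expr2 ee; ring.
  by rewrite s'0 mulr0 addr0.
have cE : c = (e * p / y) *: r.
  apply/rowP => j; rewrite !mxE; case: (ord2P j) => -> /=; rewrite -/p -/q.
    rewrite -[LHS]mul1r -ee; field; lra.
  have -> : q = x * p / y by rewrite xp; field; lra.
  rewrite -[LHS]mul1r -ee; field; lra.
by move: cv; rewrite cE; apply: strict_max_scale; rewrite divr_ge0// ltW.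
Qed.

End Plane.

(** * Nonnegative starting points *)

Section NonnegStart.
Variable R : realType.
Implicit Types (c : 'rV[R]_2) (a v : 'cV[R]_2) (A B T : 'M[R]_2).
Implicit Types (D : set 'rV[R]_2) (Sigma : set 'M[R]_2).

Definition nonneg_mx T : Prop :=
  [/\ 0 <= T 0 0, 0 <= T 0 1, 0 <= T 1 0 & 0 <= T 1 1].

Definition nonneg_cv v : Prop := 0 <= v 0 0 /\ 0 <= v 1 0.

Definition dominated c c' : Prop := c 0 0 <= c' 0 0 /\ c 0 1 <= c' 0 1.

Lemma dominated_dot c c' v :
  dominated c c' -> nonneg_cv v -> dot c v <= dot c' v.
Proof. by move=> [h0 h1] [v0 v1]; rewrite !dotE2 lerD// ler_wpM2r. Qed.

Lemma nonneg_mul T v : nonneg_mx T -> nonneg_cv v -> nonneg_cv (T *m v).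
Proof.
by move=> [h00 h01 h10 h11] [v0 v1]; split; rewrite col_mulE addr_ge0 ?mulr_ge0.
Qed.

Lemma reach_nonneg Sigma a k v : (forall T, Sigma T -> nonneg_mx T) ->
  nonneg_cv a -> reach Sigma a k v -> nonneg_cv v.
Proof.
move=> S0 a0; elim: k v => [v /reach0 -> //|k IH v].
by case/reachS => T [y [/S0 T0 /IH y0 ->]]; exact: nonneg_mul.
Qed.

Lemma vbound0 Sigma a D : vbound 1 (reach Sigma a 0) D.
Proof.
by apply/vbound_finite/at_most1 => x y /reach0 -> /reach0 ->.
Qed.

(** A strict maximizer has no rival of equal value, so the weak inequality already forces it to end
    with the letter [T]; no exposed point is added. *)
Lemma vbound_forced Sigma T D D' m a k : Sigma T -> T \in unitmx ->
  (forall c, D c -> D' (c *m T)) ->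
  (forall c v, D c -> reach Sigma a k.+1 v ->
     exists2 y, reach Sigma a k y & dot c v <= dot c (T *m y)) ->
  vbound m (reach Sigma a k) D' -> vbound m (reach Sigma a k.+1) D.
Proof.
move=> ST uT DD' forced; apply: at_most_image (mulmx T) _ _ _ _ => v [c Dc cv].
have [y ry vy] := forced c v Dc (proj1 cv).
have rT z : reach Sigma a k z -> reach Sigma a k.+1 (T *m z).
  by move=> rz; apply/reachS; exists T, z.
have vE := strict_max_le cv (rT _ ry) vy.
exists y => //; exists (c *m T); first exact: DD'.
split=> // z rz zy; rewrite !dot_mul vE; apply: (proj2 cv); first exact: rT.
by rewrite -vE (inj_eq (can_inj (mulKmx uT))).
Qed.

Lemma vbound_branch A B D D1 D2 m1 m2 a k : A \in unitmx -> B \in unitmx ->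
  (forall c, D c -> D1 (c *m A)) -> (forall c, D c -> D2 (c *m B)) ->
  vbound m1 (reach [set A; B] a k) D1 -> vbound m2 (reach [set A; B] a k) D2 ->
  vbound (m1 + m2) (reach [set A; B] a k.+1) D.
Proof.
move=> uA uB DA DB b1 b2.
pose X T := [set T *m y | y in reach [set A; B] a k].
have image T D' m : T \in unitmx -> (forall c, D c -> D' (c *m T)) ->
    vbound m (reach [set A; B] a k) D' -> vbound m (X T) D.
  move=> uT DD'; apply: at_most_image (mulmx T) _ _ _ _ => v [c Dc].
  move=> [[y ry <-] my]; exists y => //; exists (c *m T); first exact: DD'.
  split=> // z rz zy; rewrite !dot_mul; apply: my; first by exists z.
  by rewrite (inj_eq (can_inj (mulKmx uT))).
apply: vbound_cover (image _ _ _ uA DA b1) (image _ _ _ uB DB b2) => v.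
- by case/reachS => T [y [[->|->] ry ->]]; [left|right]; exists y.
- by case=> y ry <-; apply/reachS; exists A, y; split=> //; left.
- by case=> y ry <-; apply/reachS; exists B, y; split=> //; right.
Qed.

Lemma vbound_forced1 Sigma T D D' m a k :
  (forall T, Sigma T -> nonneg_mx T) -> nonneg_cv a -> Sigma T -> T \in unitmx ->
  (forall c, D c -> D' (c *m T)) ->
  (forall c T', D c -> Sigma T' -> dominated (c *m T') (c *m T)) ->
  vbound m (reach Sigma a k) D' -> vbound m (reach Sigma a k.+1) D.
Proof.
move=> S0 a0 ST uT DD' dom; apply: vbound_forced ST uT DD' _.
move=> c v Dc /reachS[T' [y [ST' ry ->]]]; exists y => //.
rewrite -!dot_mul; apply: dominated_dot (dom _ _ Dc ST') _.
exact: reach_nonneg ry.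
Qed.

(** One letter of look-ahead: [T] may fail to dominate by itself, but wins once the letter acting
    before it is chosen suitably. *)
Lemma vbound_forced2 Sigma T D D' m a k :
  (forall T, Sigma T -> nonneg_mx T) -> nonneg_cv a -> Sigma T -> T \in unitmx ->
  (forall c, D c -> D' (c *m T)) ->
  (forall c T1 T2, D c -> Sigma T1 -> Sigma T2 -> exists2 T',
     Sigma T' & dominated (c *m T1 *m T2) (c *m T *m T')) ->
  vbound m (reach Sigma a k.+1) D' -> vbound m (reach Sigma a k.+2) D.
Proof.
move=> S0 a0 ST uT DD' dom; apply: vbound_forced ST uT DD' _.
move=> c v Dc /reachS[T1 [_ [ST1 /reachS[T2 [y [ST2 ry ->]]] ->]]].
have [T' ST' d] := dom _ _ _ Dc ST1 ST2.
exists (T' *m y); first by apply/reachS; exists T', y.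
rewrite -!dot_mul; apply: dominated_dot d _.
exact: reach_nonneg ry.
Qed.

Lemma vbound_forced3 Sigma T D D' m a k :
  (forall T, Sigma T -> nonneg_mx T) -> nonneg_cv a -> Sigma T -> T \in unitmx ->
  (forall c, D c -> D' (c *m T)) ->
  (forall c T1 T2 T3, D c -> Sigma T1 -> Sigma T2 -> Sigma T3 ->
     exists T' T'', [/\ Sigma T', Sigma T'' &
       dominated (c *m T1 *m T2 *m T3) (c *m T *m T' *m T'')]) ->
  vbound m (reach Sigma a k.+2) D' -> vbound m (reach Sigma a k.+3) D.
Proof.
move=> S0 a0 ST uT DD' dom; apply: vbound_forced ST uT DD' _ => c v Dc.
case/reachS => T1 [_ [ST1 /reachS[T2 [_ [ST2 /reachS[T3 [y [ST3 ry ->]]] ->]]] ->]].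
have [T' [T'' [ST' ST'' d]]] := dom _ _ _ _ Dc ST1 ST2 ST3.
exists (T' *m (T'' *m y)).
  by apply/reachS; exists T', (T'' *m y); split=> //; apply/reachS; exists T'', y.
rewrite -!dot_mul; apply: dominated_dot d _.
exact: reach_nonneg ry.
Qed.

(** Parts of a definite quadrant with slope at most, respectively at least, [x / y]; they are the
    two sides in [vbound_split]. *)
Definition below (e x y : R) : set 'rV[R]_2 :=
  [set c | quadrant e e c /\ e * (y * c 0 1) <= e * (x * c 0 0)].
Definition above (e x y : R) : set 'rV[R]_2 :=
  [set c | quadrant e e c /\ e * (x * c 0 0) <= e * (y * c 0 1)].

Lemma below_above e : quadrant e e `<=` below e 1 1 `|` above e 1 1.
Proof.
move=> c Qc; have [h|/ltW h] := leP (e * (1 * c 0 1)) (e * (1 * c 0 0));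
  by [left|right].
Qed.

(** The letters send the quadrant to opposite sides of the diagonal, and by [vbound_split] the
    counts on the two sides add up to at most one more than the count for the whole quadrant. *)
Lemma halves_bound A B (e : R) a k : A \in unitmx -> B \in unitmx -> e ^+ 2 = 1 ->
  (forall c, quadrant e e c -> below e 1 1 (c *m A)) ->
  (forall c, quadrant e e c -> above e 1 1 (c *m B)) ->
  vbound k.+1 (reach [set A; B] a k) (quadrant e e).
Proof.
move=> uA uB ee hA hB; elim: k => [|k IH]; first exact: vbound0.
have [||m1 [m2 [le_m b1 b2]]] := vbound_split IH _ _ ltr01 ltr01 ee
  (@subset_refl _ (below e 1 1)) (@subset_refl _ (above e 1 1)).
- by move=> c [].
- by move=> c [].
by apply: vboundW le_m _ (vbound_branch uA uB hA hB b1 b2).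
Qed.

Definition dominant_letter Sigma D : Prop := exists T, exists D',
  [/\ Sigma T,
      forall c, D c -> [\/ quadrant 1 1 (c *m T), quadrant (-1) (-1) (c *m T) |
        D' (c *m T)],
      forall c T1 T2, D c -> Sigma T1 -> Sigma T2 -> exists2 T',
        Sigma T' & dominated (c *m T1 *m T2) (c *m T *m T') &
      D' = quadrant 1 (-1) \/ D' = quadrant (-1) 1].

(* In the mixed quadrants one letter dominates, and it sends the quadrant into
   the definite quadrants and a single mixed one, so the bounds add up. *)
Lemma nonneg_bound A B :
  (forall T, [set A; B] T -> nonneg_mx T /\ T \in unitmx) ->
  (forall a k, nonneg_cv a -> vbound (2 * k + 8) (reach [set A; B] a k)
     (quadrant 1 1)) ->
  (forall a k, nonneg_cv a -> vbound (2 * k + 8) (reach [set A; B] a k)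
     (quadrant (-1) (-1))) ->
  dominant_letter [set A; B] (quadrant 1 (-1)) ->
  dominant_letter [set A; B] (quadrant (-1) 1) ->
  forall a k, nonneg_cv a -> vbound (64 * k.+1 ^ 2) (reach [set A; B] a k) setT.
Proof.
move=> S0 pp nn pn np a k a0.
pose mixed D := D = quadrant 1 (-1) \/ D = quadrant (-1) 1 :> set 'rV[R]_2.
have step j m D : (forall D', mixed D' -> vbound m (reach [set A; B] a j.+1) D') ->
    mixed D -> vbound (m + 2 * (2 * j.+1 + 8)) (reach [set A; B] a j.+2) D.
  move=> IH mD; have [T [D' [ST TD dom mD']]] : dominant_letter [set A; B] D.
    by case: mD => ->.
  have S1 T' : [set A; B] T' -> nonneg_mx T' by case/S0.
  have [_ uT] := S0 T ST.
  apply: (vbound_forced2 S1 a0 ST uT (D' :=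
    (quadrant 1 1 `|` quadrant (-1) (-1)) `|` D') _ dom).
    by move=> c /TD[h|h|h]; [left; left|left; right|right].
  rewrite mulSn mul1n addnC.
  apply: (vboundU (@subset_refl _ _) _ (IH _ mD')).
  exact: (vboundU (@subset_refl _ _) (pp a j.+1 a0) (nn a j.+1 a0)).
(* The increments in [step] are linear in [j], so the sum is quadratic. Lengths 0 and 1 are treated
   apart because the look-ahead takes two letters. *)
have mixed_bound j D : mixed D -> vbound (16 * j.+1 ^ 2) (reach [set A; B] a j) D.
  elim: j D => [|[|j] IH] D mD.
  - by apply: vboundW (vbound0 _ _ D).
  - by apply: vbound_finite; apply: at_mostW (at_most_reach A B a 1).
  by apply: vboundW (step _ _ _ IH mD) => //; lia.
have all_quadrants : [set: 'rV[R]_2] `<=` ((quadrant 1 1 `|` quadrant (-1) (-1)) `|`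
    (quadrant 1 (-1) `|` quadrant (-1) 1)).
  move=> c _; rewrite /quadrant /=.
  have [c0|c0] := leP 0 (c 0 0); have [c1|c1] := leP 0 (c 0 1).
  - by left; left; split; lra.
  - by right; left; split; lra.
  - by right; right; split; lra.
  - by left; right; split; lra.
apply: vboundW (vboundU all_quadrants
  (vboundU (@subset_refl _ _) (pp a k a0) (nn a k a0))
  (vboundU (@subset_refl _ _) (mixed_bound k _ (or_introl erefl))
    (mixed_bound k _ (or_intror erefl)))) => //.
lia.
Qed.

End NonnegStart.

(** * The six pairs for nonnegative starting points *)

Section Letters.
Variable R : realType.
Implicit Types (c : 'rV[R]_2) (a v : 'cV[R]_2) (A B T : 'M[R]_2).

Local Notation J := (@mxJ R).
Local Notation U := (@mxU R).
Local Notation L := (@mxL R).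
Local Notation F := (@mxF R).
Local Notation G := (@mxG R).

Definition regular_letter T : Prop := nonneg_mx T /\ T \in unitmx.

Lemma regular_mx2 (x y z t x' y' z' t' : R) :
  0 <= x -> 0 <= y -> 0 <= z -> 0 <= t -> mx2 x y z t *m mx2 x' y' z' t' = 1%:M ->
  regular_letter (mx2 x y z t).
Proof.
move=> x0 y0 z0 t0 /mulmx1_unit[u _]; split=> //.
by split; rewrite ?mx2E.
Qed.

Lemma mxJ_sqr : J *m J = 1%:M.
Proof. by apply: mx2P; rewrite /mxJ !mx2E !mxE /=; lra. Qed.

Lemma regular_J : regular_letter J.
Proof. by apply: regular_mx2 mxJ_sqr; lra. Qed.

Lemma regular_U : regular_letter U.
Proof.
apply: (@regular_mx2 1 1 0 1 1 (-1) 0 1); [lra..|].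
by apply: mx2P; rewrite !mx2E !mxE /=; lra.
Qed.

Lemma regular_L : regular_letter L.
Proof.
apply: (@regular_mx2 1 0 1 1 1 0 (-1) 1); [lra..|].
by apply: mx2P; rewrite !mx2E !mxE /=; lra.
Qed.

Lemma regular_F : regular_letter F.
Proof.
apply: (@regular_mx2 1 1 1 0 0 1 1 (-1)); [lra..|].
by apply: mx2P; rewrite !mx2E !mxE /=; lra.
Qed.

Lemma regular_G : regular_letter G.
Proof.
apply: (@regular_mx2 0 1 1 1 (-1) 1 1 0); [lra..|].
by apply: mx2P; rewrite !mx2E !mxE /=; lra.
Qed.

Ltac entries := rewrite !row_letterE.

Ltac in_quadrant := split; entries; lra.

Ltac in_half := split; [split|]; entries; lra.

Ltac letter := first [by left | by right].

Ltac dominates A B :=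
  first [ exists B; [letter|]; split; entries; lra
        | exists A; [letter|]; split; entries; lra ].

(* The sum of the entries is the only new entry a letter can produce from [c], so its sign decides
   the quadrant of the image. *)
Tactic Notation "dominant" constr(A) constr(B) constr(T) constr(D) :=
  exists T, D; split;
  [ letter
  | let c := fresh "c" in move=> c [];
    have [?|?] := leP (c 0 0 + c 0 1) 0 => ? ?;
    first [ constructor 1; in_quadrant | constructor 2; in_quadrant
          | constructor 3; in_quadrant ]
  | move=> c T1 T2 [? ?] [->|->] [->|->]; dominates A B
  | letter ].

Definition start_bound A B : Prop := forall a k, nonneg_cv a ->
  vbound (64 * k.+1 ^ 2) (reach [set A; B] a k) setT.

Lemma halves_start_bound A B : regular_letter A -> regular_letter B ->
  (forall e : R, e ^+ 2 = 1 -> forall c, quadrant e e c -> below e 1 1 (c *m A)) ->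
  (forall e : R, e ^+ 2 = 1 -> forall c, quadrant e e c -> above e 1 1 (c *m B)) ->
  dominant_letter [set A; B] (quadrant 1 (-1)) ->
  dominant_letter [set A; B] (quadrant (-1) 1) -> start_bound A B.
Proof.
move=> rA rB hA hB; apply: nonneg_bound => [T [->|->] //|a k _|a k _].
- have ee : 1 ^+ 2 = 1 :> R by rewrite expr1n.
  have := halves_bound a k (proj2 rA) (proj2 rB) ee (hA _ ee) (hB _ ee).
  apply: vboundW => //.
  lia.
- have ee : (-1) ^+ 2 = 1 :> R by rewrite sqrrN expr1n.
  have := halves_bound a k (proj2 rA) (proj2 rB) ee (hA _ ee) (hB _ ee).
  apply: vboundW => //.
  lia.
Qed.

Lemma start_bound_LU : start_bound L U.
Proof.
apply: (halves_start_bound regular_L regular_U) => [e _ c [? ?]|e _ c [? ?]||].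
- in_half.
- in_half.
- dominant L U U (quadrant 1 (-1) : set 'rV[R]_2).
- dominant L U L (quadrant (-1) 1 : set 'rV[R]_2).
Qed.

Lemma start_bound_FU : start_bound F U.
Proof.
apply: (halves_start_bound regular_F regular_U) => [e _ c [? ?]|e _ c [? ?]||].
- in_half.
- in_half.
- dominant F U U (quadrant 1 (-1) : set 'rV[R]_2).
(* Here the look-ahead matters: [c *m F] and [c *m U] are in general incomparable, but become
   comparable when both are followed by the same letter. *)
- dominant F U F (quadrant 1 (-1) : set 'rV[R]_2).
Qed.

Lemma start_bound_FG : start_bound F G.
Proof.
apply: (halves_start_bound regular_F regular_G) => [e _ c [? ?]|e _ c [? ?]||].
- in_half.
- in_half.
- dominant F G F (quadrant (-1) 1 : set 'rV[R]_2).
- dominant F G G (quadrant 1 (-1) : set 'rV[R]_2).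
Qed.

(** One letter wins throughout a cone that it preserves, so the maximizing word is constant and does
    not depend on the functional. *)
Lemma stable_cone_bound A B T (D : set 'rV[R]_2) a k :
  regular_letter A -> regular_letter B -> nonneg_cv a -> [set A; B] T ->
  (forall c, D c -> D (c *m T)) ->
  (forall c T', D c -> [set A; B] T' -> dominated (c *m T') (c *m T)) ->
  vbound 1 (reach [set A; B] a k) D.
Proof.
move=> rA rB a0 ST DT dom; elim: k => [|k IH]; first exact: vbound0.
apply: (vbound_forced1 _ a0 ST _ DT dom IH) => [T' [->|->]|].
- by case: rA.
- by case: rB.
- by case: ST => ->; [case: rA|case: rB].
Qed.

(** [F] is [J] with one more entry 1, so [F] wins on nonnegative functionals and [J] on nonpositive
    ones; each preserves its quadrant. *)
Lemma start_bound_JF : start_bound J F.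
Proof.
apply: nonneg_bound => [T [->|->]|a k a0|a k a0||].
- exact: regular_J.
- exact: regular_F.
- have := @stable_cone_bound J F F (quadrant 1 1) a k regular_J regular_F a0.
  case=> [|c [? ?]|c T' [? ?] [->|->]|s [ss sP]]; first by letter.
  + by in_quadrant.
  + by split; entries; lra.
  + by split; entries; lra.
  by exists s; split=> //; lia.
- have := @stable_cone_bound J F J (quadrant (-1) (-1)) a k regular_J regular_F a0.
  case=> [|c [? ?]|c T' [? ?] [->|->]|s [ss sP]]; first by letter.
  + by in_quadrant.
  + by split; entries; lra.
  + by split; entries; lra.
  by exists s; split=> //; lia.
- dominant J F F (quadrant (-1) 1 : set 'rV[R]_2).
- dominant J F J (quadrant 1 (-1) : set 'rV[R]_2).
Qed.

(** [c *m U] and [c *m G] differ only in their first entries, [c 0 0] and [c 0 1], so the diagonal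
    decides which letter wins. The upper half is stable under its winner and the lower half is sent
    into the upper one: one point each. *)
Lemma start_bound_UG : start_bound U G.
Proof.
have half e T T' a k : nonneg_cv a ->
    (e = 1 /\ T = G /\ T' = U) \/ (e = -1 /\ T = U /\ T' = G) ->
    vbound (2 * k + 8) (reach [set U; G] a k) (quadrant e e).
  move=> a0 eT.
  have up j : vbound 1 (reach [set U; G] a j) (above e 1 1).
    apply: (@stable_cone_bound U G T _ a j regular_U regular_G a0).
    - by case: eT => [[_ [-> _]]|[_ [-> _]]]; letter.
    - case: eT => [[-> [-> _]]|[-> [-> _]]] c [[? ?] ?]; in_half.
    - by case: eT => [[-> [-> _]]|[-> [-> _]]] c T1 [[? ?] ?] [->|->];
        split; entries; lra.
  case: k => [|k]; first by apply: vboundW (vbound0 _ _ (quadrant e e)).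
  have S0 T1 : [set U; G] T1 -> nonneg_mx T1.
    by case=> ->; [case: regular_U|case: regular_G].
  have down : vbound 1 (reach [set U; G] a k.+1) (below e 1 1).
    apply: (vbound_forced1 S0 a0 (T := T') _ _ _ _ (up k)).
    - by case: eT => [[_ [_ ->]]|[_ [_ ->]]]; letter.
    - by case: eT => [[_ [_ ->]]|[_ [_ ->]]]; [case: regular_U|case: regular_G].
    - case: eT => [[-> [_ ->]]|[-> [_ ->]]] c [[? ?] ?]; in_half.
    - by case: eT => [[-> [_ ->]]|[-> [_ ->]]] c T1 [[? ?] ?] [->|->];
        split; entries; lra.
  by apply: vboundW (vboundU (@below_above _ e) down (up k.+1)) => //; lia.
apply: nonneg_bound => [T [->|->]|a k a0|a k a0||].
- exact: regular_U.
- exact: regular_G.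
- by apply: (half 1 G U) => //; left.
- by apply: (half (-1) U G) => //; right.
- dominant U G U (quadrant 1 (-1) : set 'rV[R]_2).
- dominant U G G (quadrant 1 (-1) : set 'rV[R]_2).
Qed.

Lemma start_bound_JU : start_bound J U.
Proof.
have S0 T1 : [set J; U] T1 -> nonneg_mx T1.
  by case=> ->; [case: regular_J|case: regular_U].
have [_ uJ] := regular_J; have [_ uU] := regular_U.
apply: nonneg_bound => [T [->|->]|a k a0|a k a0||].
- exact: regular_J.
- exact: regular_U.
(* The invariant concerns the sum of the counts for the two halves, which grows by at most one per
   letter. *)
- have [m1 [m2 [le_m b1 b2]]] : exists m1 m2, [/\ (m1 + m2 <= k + 2)%N,
      vbound m1 (reach [set J; U] a k) (below 1 1 1) &
      vbound m2 (reach [set J; U] a k) (above 1 1 1)].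
    elim: k => [|k [n1 [n2 [le_n b1 b2]]]].
      by exists 1%N, 1%N; split=> //; exact: vbound0.
    (* U maps the lower half into slopes [1, 2] and the upper half into slopes
       at least 2. *)
    have [|||||||m1 [m2 [le_m c1 c2]]] := @vbound_split R n2
      (reach [set J; U] a k) (above 1 1 1) (above 1 1 1 `&` below 1 2 1)
      (above 1 2 1) 1 2 1 b2.
    + by move=> c [].
    + by move=> c [[? ?] ?]; split; [split|]; lra.
    + by lra.
    + by lra.
    + by rewrite expr1n.
    + by move=> c [].
    + by [].
    exists m1, (n1 + m2)%N; split; first by lia.
      apply: (vbound_forced1 S0 a0 (T := U) _ uU _ _ c1); first by letter.
        by move=> c [[? ?] ?]; split; in_half.
      by move=> c T [[? ?] ?] [->|->]; split; entries; lra.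
    by apply: (vbound_branch uJ uU _ _ b1 c2) => c [[? ?] ?]; in_half.
  by apply: vboundW (vboundU (@below_above _ 1) b1 b2) => //; lia.
(* From length 3 on, [J] is forced and preserves the quadrant, so the count stays below that of the
   [2 ^ 2] words of length 2. *)
- suff b4 : vbound 4 (reach [set J; U] a k) (quadrant (-1) (-1)).
    by apply: vboundW b4 => //; lia.
  elim: k => [|[|[|k]] IH].
  + by apply: vboundW (vbound0 _ a (quadrant (-1) (-1))).
  + by apply: vbound_finite; apply: at_mostW (at_most_reach J U a 1).
  + by apply: vbound_finite; apply: at_mostW (at_most_reach J U a 2).
  apply: (vbound_forced3 S0 a0 (T := J) _ uJ _ _ IH); first by letter.
    by move=> c [? ?]; in_quadrant.
  (* Words whose first factor is [J] are kept. The others are replaced by [J J U] or [J J J], which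
     act as [U] or [J] and have larger entries on nonpositive functionals. *)
  move=> c T1 T2 T3 [? ?] [->|->] [->|->] [->|->];
    [exists J, J|exists J, U|exists U, J|exists U, U
    |exists J, U|exists J, U|exists J, J|exists J, U];
    by split; [letter|letter|split; entries; lra].
- dominant J U U (quadrant 1 (-1) : set 'rV[R]_2).
- dominant J U J (quadrant 1 (-1) : set 'rV[R]_2).
Qed.

End Letters.

(** * Starting points of mixed signs *)

Section MixedStart.
Variable R : realType.
Implicit Types (a b v : 'cV[R]_2) (A B T J : 'M[R]_2) (Sigma : set 'M[R]_2).

Definition definite v : Prop :=
  (0 <= v 0 0 /\ 0 <= v 1 0) \/ (v 0 0 <= 0 /\ v 1 0 <= 0).
Definition mixed v : Prop :=
  (0 <= v 0 0 /\ v 1 0 <= 0) \/ (v 0 0 <= 0 /\ 0 <= v 1 0).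

Lemma definite_or_mixed v : definite v \/ mixed v.
Proof.
rewrite /definite /mixed; have [?|/ltW ?] := leP 0 (v 0 0);
  have [?|/ltW ?] := leP 0 (v 1 0);
  [left; left|right; left|right; right|left; right]; by [].
Qed.

Lemma definite_bound A B a k : start_bound A B -> definite a ->
  vbound (64 * k.+1 ^ 2) (reach [set A; B] a k) setT.
Proof.
move=> AB [a0|[a0 a1]]; first exact: AB.
rewrite -[a]opprK reach_opp; apply: vbound_opp; apply: AB.
by split; rewrite mxE oppr_ge0.
Qed.

(** One increment of the recursion on the length: a single branch continues from an arbitrary start,
    at most two continue from definite starts at a quadratic cost each, and one extra point is
    allowed for the words in an involution alone. *)
Definition mixed_step A B : Prop := forall a k m, mixed a ->
  (forall b i, (i <= k.+1)%N -> definite b ->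
     vbound (64 * k.+2 ^ 2) (reach [set A; B] b i) setT) ->
  (forall b i, (i <= k.+1)%N ->
     vbound (m + 64 * k.+2 ^ 2) (reach [set A; B] b i) setT) ->
  vbound (m + 3 * (64 * k.+2 ^ 2) + 1) (reach [set A; B] a k.+2) setT.

Definition cubic_bound A B : Prop := forall a k,
  vbound (200 * k.+1 ^ 3) (reach [set A; B] a k) setT.

Lemma mixed_step_bound A B :
  start_bound A B -> mixed_step A B -> cubic_bound A B.
Proof.
move=> AB step a k.
have [k' kk'] := ubnP k; elim: k' => // k' IH in a k kk' *.
have [da|ma] := definite_or_mixed a.
  by apply: vboundW (definite_bound k AB da) => //; lia.
case: k kk' => [|[|k]] kk'.
- by apply: vboundW (vbound0 _ a setT).
- by apply: vbound_finite; apply: at_mostW (at_most_reach A B a 1).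
have db b i : (i <= k.+1)%N -> definite b ->
    vbound (64 * k.+2 ^ 2) (reach [set A; B] b i) setT.
  by move=> ik hb; apply: vboundW (definite_bound i AB hb) => //; nia.
have mb b i : (i <= k.+1)%N ->
    vbound (200 * k.+2 ^ 3 + 64 * k.+2 ^ 2) (reach [set A; B] b i) setT.
  move=> ik; apply: vboundW (IH b i _) => //; last by lia.
  have : (i.+1 ^ 3 <= k.+2 ^ 3)%N by rewrite leq_exp2r.
  lia.
(* The quadratic increment is below [200 * (k.+3 ^ 3 - k.+2 ^ 3)], which is at least
   [600 * k.+2 ^ 2]. *)
apply: vboundW (step a k _ ma db mb) => //.
by rewrite !expnS !expn0; nia.
Qed.

Lemma reach_letter A B T a k :
  [set A; B] T -> reach [set A; B] (T *m a) k `<=` reach [set A; B] a k.+1.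
Proof. by move=> ST v rv; apply/reachSr; exists T. Qed.

Lemma reach_cover A B a k : reach [set A; B] a k.+1 `<=`
  reach [set A; B] (A *m a) k `|` reach [set A; B] (B *m a) k.
Proof. by move=> v /reachSr[T [[->|->] rv]]; [left|right]. Qed.

Lemma vbound_letters A B m1 m2 a k :
  vbound m1 (reach [set A; B] (A *m a) k) setT ->
  vbound m2 (reach [set A; B] (B *m a) k) setT ->
  vbound (m1 + m2) (reach [set A; B] a k.+1) setT.
Proof.
by apply: vbound_cover; [exact: reach_cover|apply: reach_letter; left|
  apply: reach_letter; right].
Qed.

Lemma exclusive_mixed_step A B :
  (forall a, mixed a -> definite (A *m a) \/ definite (B *m a)) ->
  mixed_step A B.
Proof.
move=> excl a k m /excl[dA|dB] db mb.
- have := vbound_letters (db _ k.+1 _ dA) (mb (B *m a) k.+1 _).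
  by move=> b; apply: vboundW (b _ _) => //; lia.
- have := vbound_letters (mb (A *m a) k.+1 _) (db _ k.+1 _ dB).
  by move=> b; apply: vboundW (b _ _) => //; lia.
Qed.

Lemma delayed_mixed_step A B :
  (forall a, mixed a ->
     (definite (A *m (A *m a)) /\ definite (B *m (A *m a))) \/
     (definite (A *m (B *m a)) /\ definite (B *m (B *m a)))) ->
  mixed_step A B.
Proof.
move=> next a k m /next[[dA dB]|[dA dB]] db mb.
- have b1 := vbound_letters (db _ k _ dA) (db _ k _ dB).
  apply: vboundW (vbound_letters (b1 _ _) (mb (B *m a) k.+1 _)) => //; lia.
- have b1 := vbound_letters (db _ k _ dA) (db _ k _ dB).
  apply: vboundW (vbound_letters (mb (A *m a) k.+1 _) (b1 _ _)) => //; lia.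
Qed.

Lemma reach_involution J T a k : J *m J = 1%:M ->
  reach [set J; T] a k `<=` reach [set J; T] a k.+2.
Proof.
move=> JJ v rv; apply/reachS; exists J, (J *m v).
rewrite mulmxA JJ mul1mx; split=> //; first by left.
by apply/reachS; exists J, v; split=> //; left.
Qed.

(* Since J ^ 2 = 1, a word over J and T that contains T can be rewritten, at
   the same length, so that it starts with T or with J followed by T. *)
Lemma reach_involution_cover J T a k : J *m J = 1%:M ->
  reach [set J; T] a k.+2 `<=` [set iter k.+2 (mulmx J) a] `|`
    (reach [set J; T] (T *m a) k.+1 `|` reach [set J; T] (T *m (J *m a)) k).
Proof.
move=> JJ; have JK b : J *m (J *m b) = b by rewrite mulmxA JJ mul1mx.
have [k' kk'] := ubnP k; elim: k' => // k' IH in k kk' * => v.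
move=> /reachSr[T1 [[->|->]]]; last by right; left.
move=> /reachSr[T2 [[->|->]]]; last by right; right.
(* A word starting with [J J] acts as the rest of the word, to which the induction applies;
   [reach_involution] restores the length by two letters [J] at the end. *)
rewrite JK; case: k kk' => [|[|k]] kk'.
- by move=> /reach0 ->; left; rewrite /= JK.
- move=> /reachSr[T3 [[->|->] /reach0 ->]]; first by left; rewrite /= JK.
  by right; left; apply: reach_involution => //; exact/reach0.
case/IH => [|->|[r|r]]; first by lia.
- by left; rewrite /= JK.
- by right; left; exact: reach_involution.
- by right; right; exact: reach_involution.
Qed.

Lemma involution_mixed_step J T : J *m J = 1%:M ->
  (forall a, mixed a -> definite (T *m a) \/ definite (T *m (J *m a))) ->
  mixed_step J T.
Proof.
move=> JJ excl a k m ma db mb.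
pose pure : set 'cV[R]_2 := [set iter k.+2 (mulmx J) a].
have pureP : pure `<=` reach [set J; T] a k.+2.
  move=> v ->; elim: k.+2 => [|j IH]; first exact/reach0.
  by apply/reachS; exists J, (iter j (mulmx J) a); split=> //; left.
have pure1 : vbound 1 pure setT.
  by apply/vbound_finite/at_most1 => x y -> ->.
have T1P : reach [set J; T] (T *m a) k.+1 `<=` reach [set J; T] a k.+2.
  by apply: reach_letter; right.
have T2P : reach [set J; T] (T *m (J *m a)) k `<=` reach [set J; T] a k.+2.
  move=> v rv; apply: (@reach_letter J T J); first by left.
  by apply: reach_letter rv; right.
have cover m1 m2 : vbound m1 (reach [set J; T] (T *m a) k.+1) setT ->
    vbound m2 (reach [set J; T] (T *m (J *m a)) k) setT ->
    vbound (1 + (m1 + m2)) (reach [set J; T] a k.+2) setT.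
  move=> b1 b2; apply: (vbound_cover (reach_involution_cover JJ) pureP _ pure1).
    by move=> v [/T1P|/T2P].
  apply: vbound_cover b1 b2 => // v r; by [left|right].
case: (excl a ma) => d.
- by apply: vboundW (cover _ _ (db _ k.+1 _ d) (mb _ k _)) => //; lia.
- by apply: vboundW (cover _ _ (mb _ k.+1 _) (db _ k _ d)) => //; lia.
Qed.

(** * The six pairs for arbitrary starting points, and the reduction to them *)

Local Notation J := (@mxJ R).
Local Notation U := (@mxU R).
Local Notation L := (@mxL R).
Local Notation F := (@mxF R).
Local Notation G := (@mxG R).

Ltac signs := rewrite /definite /mixed !col_letterE.

(** For entries of opposite signs, the sum shares its sign with one of them; the letter that keeps
    that entry beside the sum gives a definite vector. *)
Lemma cubic_bound_LU : cubic_bound L U.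
Proof.
apply: mixed_step_bound (@start_bound_LU R) (exclusive_mixed_step _) => a.
signs; have [?|?] := leP 0 (a 0 0 + a 1 0) => -[[? ?]|[? ?]].
- by left; left; split; lra.
- by right; left; split; lra.
- by right; right; split; lra.
- by left; right; split; lra.
Qed.

Lemma cubic_bound_FU : cubic_bound F U.
Proof.
apply: mixed_step_bound (@start_bound_FU R) (exclusive_mixed_step _) => a.
signs; have [?|?] := leP 0 (a 0 0 + a 1 0) => -[[? ?]|[? ?]].
- by left; left; split; lra.
- by right; left; split; lra.
- by right; right; split; lra.
- by left; right; split; lra.
Qed.

Lemma cubic_bound_FG : cubic_bound F G.
Proof.
apply: mixed_step_bound (@start_bound_FG R) (exclusive_mixed_step _) => a.
signs; have [?|?] := leP 0 (a 0 0 + a 1 0) => -[[? ?]|[? ?]].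
- by left; left; split; lra.
- by right; left; split; lra.
- by right; right; split; lra.
- by left; right; split; lra.
Qed.

Lemma cubic_bound_UG : cubic_bound U G.
Proof.
apply: mixed_step_bound (@start_bound_UG R) (delayed_mixed_step _) => a.
(* Both two-letter images through [U] have the entries [a 1 0] and [a 0 0 + 2 * a 1 0]; both through
   [G] have [a 0 0 + a 1 0] and the same second number, whose sign therefore selects the branch. *)
signs; have [?|?] := leP 0 (a 0 0 + 2 * a 1 0) => -[[? ?]|[? ?]].
- by right; split; left; split; lra.
- by left; split; left; split; lra.
- by left; split; right; split; lra.
- by right; split; right; split; lra.
Qed.

Lemma cubic_bound_JU : cubic_bound J U.
Proof.
apply: mixed_step_bound (@start_bound_JU R) _.
apply: involution_mixed_step (@mxJ_sqr R) _ => a.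
signs; have [?|?] := leP 0 (a 0 0 + a 1 0) => -[[? ?]|[? ?]].
- by right; left; split; lra.
- by left; left; split; lra.
- by left; right; split; lra.
- by right; right; split; lra.
Qed.

Lemma cubic_bound_JF : cubic_bound J F.
Proof.
apply: mixed_step_bound (@start_bound_JF R) _.
apply: involution_mixed_step (@mxJ_sqr R) _ => a.
signs; have [?|?] := leP 0 (a 0 0 + a 1 0) => -[[? ?]|[? ?]].
- by left; left; split; lra.
- by right; left; split; lra.
- by right; right; split; lra.
- by left; right; split; lra.
Qed.

Lemma cubic_bound_sym A B : cubic_bound A B -> cubic_bound B A.
Proof. by rewrite /cubic_bound setUC. Qed.

Lemma cubic_bound_commute A B : A *m B = B *m A -> cubic_bound A B.
Proof.
move=> AB a k; apply: vboundW (commuting_bound a k AB) => //.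
by rewrite !expnS; nia.
Qed.

Lemma cubic_bound_rank1 (u : 'cV[R]_2) (w : 'rV[R]_2) B : cubic_bound (u *m w) B.
Proof.
move=> a k; apply: vboundW (rank1_bound u w B a k) => //.
by rewrite !expnS; nia.
Qed.

Lemma cubic_bound_conjJ A B A' B' : A' = J *m A *m J -> B' = J *m B *m J ->
  cubic_bound A B -> cubic_bound A' B'.
Proof. by move=> -> -> AB a k; apply: conj_bound (@mxJ_sqr R) _ a => b. Qed.

Lemma conj_JJ : J = J *m J *m J.
Proof. by rewrite mxJ_sqr mul1mx. Qed.

Lemma conj_JU : L = J *m U *m J.
Proof. by apply: mx2P; rewrite /mxJ /mxU /mxL !mx2E; ring. Qed.

Lemma conj_JF : G = J *m F *m J.
Proof. by apply: mx2P; rewrite /mxJ /mxF /mxG !mx2E; ring. Qed.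

Lemma conj_JG : F = J *m G *m J.
Proof. by apply: mx2P; rewrite /mxJ /mxF /mxG !mx2E; ring. Qed.

Lemma binary_cubic_bound A B : binary_mx A -> binary_mx B -> cubic_bound A B.
Proof.
move=> /binary_mx2[[u [w ->]] _|hA]; first exact: cubic_bound_rank1.
move=> /binary_mx2[[u [w ->]]|hB].
  exact/cubic_bound_sym/cubic_bound_rank1.
(* Ten unordered pairs of distinct letters other than the identity remain: six are treated directly,
   and these four are their conjugates under the swap. *)
have JL := cubic_bound_conjJ conj_JJ conj_JU cubic_bound_JU.
have JG := cubic_bound_conjJ conj_JJ conj_JF cubic_bound_JF.
have GL := cubic_bound_conjJ conj_JF conj_JU cubic_bound_FU.
have LF := cubic_bound_conjJ conj_JU conj_JG cubic_bound_UG.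
have sym := cubic_bound_sym.
case: hA => [->|->|[->|->|[->|->]]]; case: hB => [->|->|[->|->|[->|->]]];
  try (by apply: cubic_bound_commute; rewrite ?mul1mx ?mulmx1);
  first [ exact: cubic_bound_LU | exact: cubic_bound_FU | exact: cubic_bound_FG
        | exact: cubic_bound_UG | exact: cubic_bound_JU | exact: cubic_bound_JF
        | by [] | apply: sym; first [ exact: cubic_bound_LU
        | exact: cubic_bound_FU | exact: cubic_bound_FG | exact: cubic_bound_UG
        | exact: cubic_bound_JU | exact: cubic_bound_JF | by [] ] ].
Qed.

End MixedStart.

Theorem theorem2 (R : realType) (A B : 'M[R]_2)
    (hA : binary_mx A) (hB : binary_mx B) :
  oligo_vertex [set A; B].
Proof. exact: oligo_vertex_bound (binary_cubic_bound hA hB). Qed.
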